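(* The following seven identities hold (as polynomial identities in the variable $x$): \begin{enumerate} \item[(1)] $\binom{12x^2-12x+3}{3}+\binom{x}{2}=\binom{24x^3-36x^2+15x-1}{2}$. \item[(2)] $\binom{12x^2-12x+5}{3}+\binom{x}{2}=\binom{24x^3-36x^2+21x-4}{2}$. \item[(3)] $\binom{60x^2-60x+15}{5}+\binom{x}{2}=\binom{a}{2}$, where $a=3600x^5-9000x^4+8700x^3-4050x^2+905x-77$. \item[(4)] $\binom{60x^2-60x+19}{5}+\binom{x}{2}=\binom{a}{2}$, where $a=3600x^5-9000x^4+9300x^3-4950x^2+1355x-152$. \item[(5)] $\binom{240x^2-240x+62}{5}+\binom{3x-1}{2}=\binom{a}{2}$, where $a=115200x^5-288000x^4+288000x^3-144000x^2+35995x-3597$. \item[(6)] $\binom{11340x^2+11340x+2835}{9}+\binom{y}{2}=\binom{a}{2}$, where $y=22680x^3+34020x^2+17001x+2831$ and $a=4134207084840000x^9+18603931881780000x^8+37201301530092000x^7+43386206573682000x^6+32522432635935900x^5+16249739546454750x^4+5411800833695550x^3+1158443736409575x^2+144626588131776x+8023467184451$. \item[(7)] $\binom{11340x^2+11340x+2843}{9}+\binom{y}{2}=\binom{a}{2}$, where $y=22680x^3+34020x^2+17019x+2840$ and $a=4134207084840000x^9+18603931881780000x^8+37214425997028000x^7+43432142207958000x^6+32591336087349900x^5+16307159089299750x^4+5440510606648950x^3+1167056670132675x^2+146062077851076x+8126002273751$. \end{enumerate}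
   Context: For a polynomial $P\in\mathbb{Q}[x]$ and an integer $k\ge 0$, $\binom{P}{k}$ denotes the polynomial $\frac{1}{k!}P(P-1)\cdots(P-k+1)\in\mathbb{Q}[x]$. *)

(* Defs.v *)
From mathcomp Require Import all_boot all_order all_algebra.

Set Implicit Arguments.
Unset Strict Implicit.
Unset Printing Implicit Defensive.

Import GRing.Theory.
Local Open Scope ring_scope.

Definition binom_poly (P : {poly rat}) (k : nat) : {poly rat} :=
  (k`!%:R)^-1 *: \prod_(i < k) (P - i%:R).

(* Main.v *)
Require Import Defs.
From mathcomp Require Import all_boot all_order all_algebra.
From mathcomp Require Import ring.

Import GRing.Theory.
Local Open Scope ring_scope.

(** Since C(a, 2) - C(y, 2) = (a - y) (a + y - 1) / 2, each identity asks for a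
    factorization of 2 C(P, k) into two factors u = a - y and v = a + y - 1
    whose difference is 2 y - 1.

    In all seven cases k is odd and there is a root r in {0, ..., k - 1} such
    that P - r is a constant multiple of the square of a linear polynomial t.
    The other k - 1 factors P - i are split into two groups of equal size, with
    products A and B, and each group receives one copy of t: u = t A / s and
    v = t B / s, where the constant s is determined by
    2 s^2 (P - r) = k! t^2.  Lemma [binom_poly_split] says that this suffices.

    The choice of the groups makes v - u of low degree, hence y small next to a.
    For k = 3 the groups are singletons, and for k = 5 they are pairs with the
    same sum, so that B - A is constant and y is linear.  For k = 9 they solve
    the Prouhet-Tarry-Escott problem of degree 2, that is,
    1 + 4 + 6 + 7 = 2 + 3 + 5 + 8 and
    1^2 + 4^2 + 6^2 + 7^2 = 2^2 + 3^2 + 5^2 + 8^2 (or the same sets shifted by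
    one, which give the Thue-Morse partition of {0, ..., 7}); then B - A has
    degree 1 in P and y is a cubic.  For each identity it remains to name r, t,
    s and the two groups and to expand. *)

Local Lemma binom_poly2 (a : {poly rat}) :
  binom_poly a 2 = 2%:R^-1 *: (a * (a - 1)).
Proof. by rewrite /binom_poly !big_ord_recl big_ord0 /= subr0 mulr1. Qed.

(** The list [sA] gives the group A of the idea above and [sB] the group B.
    Multiplied by s^2, the product u v becomes t^2 A B, which is
    2 s^2 / k! times (P - r) A B, the full product of the P - i. *)
Local Lemma binom_poly_split (r : nat) (sA sB : seq nat) (t : {poly rat})
    (s : nat) (P a y : {poly rat}) (k : nat) :
    (0 < s)%N ->
    perm_eq (r :: sA ++ sB) (iota 0 k) ->
    (2 * s ^ 2)%:R * (P - r%:R) = k`!%:R * t ^+ 2 ->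
    s%:R * (a - y) = t * \prod_(i <- sA) (P - i%:R) ->
    s%:R * (a + y - 1) = t * \prod_(i <- sB) (P - i%:R) ->
  binom_poly P k + binom_poly y 2 = binom_poly a 2.
Proof.
set Q := P - r%:R; set A := \prod_(i <- sA) _; set B := \prod_(i <- sB) _.
move=> s_gt0 groups QE uE vE.
have prodE : \prod_(i < k) (P - i%:R) = Q * A * B.
  rewrite -(big_mkord xpredT (fun i => P - i%:R)) /index_iota subn0.
  by rewrite -(perm_big _ groups) big_cons big_cat /= mulrA.
have s_neq0 : s%:R != 0 :> {poly rat}.
  by rewrite -polyC_natr polyC_eq0 Num.Theory.pnatr_eq0 -lt0n.
have main : 2%:R * (Q * A * B) = k`!%:R * ((a - y) * (a + y - 1)).
  apply: (mulfI (expf_neq0 2 s_neq0)).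
  transitivity ((2 * s ^ 2)%:R * Q * A * B); first by rewrite natrM natrX; ring.
  transitivity (k`!%:R * ((s%:R * (a - y)) * (s%:R * (a + y - 1)))); last by ring.
  by rewrite QE uE vE; ring.
have natZ n (p : {poly rat}) : n%:R *: p = n%:R * p.
  by rewrite scaler_nat mulr_natl.
have f_neq0 : k`!%:R != 0 :> rat.
  by rewrite Num.Theory.pnatr_eq0 -lt0n fact_gt0.
have scaled : binom_poly P k = 2%:R^-1 *: ((a - y) * (a + y - 1)).
  apply: (scalerI f_neq0); rewrite /binom_poly prodE scalerA divff // scale1r.
  by rewrite scalerA [_ * 2%:R^-1]mulrC -scalerA natZ -main -natZ scalerK.
rewrite scaled !binom_poly2 -scalerDr; congr (_ *: _); ring.
Qed.

Theorem mainTheorem2 :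
  (binom_poly (12%:R * 'X^2 - 12%:R * 'X + 3%:R) 3 + binom_poly 'X 2 =
    binom_poly (24%:R * 'X^3 - 36%:R * 'X^2 + 15%:R * 'X - 1%:R) 2) /\
  (binom_poly (12%:R * 'X^2 - 12%:R * 'X + 5%:R) 3 + binom_poly 'X 2 =
    binom_poly (24%:R * 'X^3 - 36%:R * 'X^2 + 21%:R * 'X - 4%:R) 2) /\
  (let a : {poly rat} :=
    3600%:R * 'X^5 - 9000%:R * 'X^4 + 8700%:R * 'X^3 - 4050%:R * 'X^2
    + 905%:R * 'X - 77%:R in
   binom_poly (60%:R * 'X^2 - 60%:R * 'X + 15%:R) 5 + binom_poly 'X 2 =
    binom_poly a 2) /\
  (let a : {poly rat} :=
    3600%:R * 'X^5 - 9000%:R * 'X^4 + 9300%:R * 'X^3 - 4950%:R * 'X^2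
    + 1355%:R * 'X - 152%:R in
   binom_poly (60%:R * 'X^2 - 60%:R * 'X + 19%:R) 5 + binom_poly 'X 2 =
    binom_poly a 2) /\
  (let a : {poly rat} :=
    115200%:R * 'X^5 - 288000%:R * 'X^4 + 288000%:R * 'X^3
    - 144000%:R * 'X^2 + 35995%:R * 'X - 3597%:R in
   binom_poly (240%:R * 'X^2 - 240%:R * 'X + 62%:R) 5
    + binom_poly (3%:R * 'X - 1%:R) 2 =
    binom_poly a 2) /\
  (let y : {poly rat} :=
    22680%:R * 'X^3 + 34020%:R * 'X^2 + 17001%:R * 'X + 2831%:R in
  let a : {poly rat} :=
    4134207084840000%:R * 'X^9 + 18603931881780000%:R * 'X^8
    + 37201301530092000%:R * 'X^7 + 43386206573682000%:R * 'X^6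
    + 32522432635935900%:R * 'X^5 + 16249739546454750%:R * 'X^4
    + 5411800833695550%:R * 'X^3 + 1158443736409575%:R * 'X^2
    + 144626588131776%:R * 'X + 8023467184451%:R in
   binom_poly (11340%:R * 'X^2 + 11340%:R * 'X + 2835%:R) 9 + binom_poly y 2 =
    binom_poly a 2) /\
  (let y : {poly rat} :=
    22680%:R * 'X^3 + 34020%:R * 'X^2 + 17019%:R * 'X + 2840%:R in
  let a : {poly rat} :=
    4134207084840000%:R * 'X^9 + 18603931881780000%:R * 'X^8
    + 37214425997028000%:R * 'X^7 + 43432142207958000%:R * 'X^6
    + 32591336087349900%:R * 'X^5 + 16307159089299750%:R * 'X^4
    + 5440510606648950%:R * 'X^3 + 1167056670132675%:R * 'X^2
    + 146062077851076%:R * 'X + 8126002273751%:R in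
   binom_poly (11340%:R * 'X^2 + 11340%:R * 'X + 2843%:R) 9 + binom_poly y 2 =
    binom_poly a 2).
Proof.
(* In each case r, the two groups, t and s, in this order. *)
split; [|split; [|split; [|split; [|split; [|split]]]]].
- apply: (binom_poly_split 0 [:: 2] [:: 1] (2%:R * 'X - 1) 1) => //;
    rewrite ?factS ?fact0 ?big_cons ?big_nil; ring.
- apply: (binom_poly_split 2 [:: 1] [:: 0] (2%:R * 'X - 1) 1) => //;
    rewrite ?factS ?fact0 ?big_cons ?big_nil; ring.
- move=> a; apply: (binom_poly_split 0 [:: 1; 4] [:: 2; 3] (2%:R * 'X - 1) 2) => //;
    rewrite ?factS ?fact0 ?big_cons ?big_nil /a; ring.
- move=> a; apply: (binom_poly_split 4 [:: 0; 3] [:: 1; 2] (2%:R * 'X - 1) 2) => //;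
    rewrite ?factS ?fact0 ?big_cons ?big_nil /a; ring.
- move=> a; apply: (binom_poly_split 2 [:: 0; 4] [:: 1; 3] (2%:R * 'X - 1) 1) => //;
    rewrite ?factS ?fact0 ?big_cons ?big_nil /a; ring.
- move=> y a;
  apply: (binom_poly_split 0 [:: 2; 3; 5; 8] [:: 1; 4; 6; 7] (2%:R * 'X + 1) 8) => //;
    rewrite ?factS ?fact0 ?big_cons ?big_nil /a /y; ring.
- move=> y a;
  apply: (binom_poly_split 8 [:: 1; 2; 4; 7] [:: 0; 3; 5; 6] (2%:R * 'X + 1) 8) => //;
    rewrite ?factS ?fact0 ?big_cons ?big_nil /a /y; ring.
Qed.
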